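(* Let $N\geq 3$ be an integer and let $q$ be a prime power with $q\geq N^2$. Let $B_1,\dots,B_N$ be point sets in $\mathrm{PG}(N,q)$, each of which is either a line or a Baer subplane. Then $\bigcup_{i=1}^N B_i$ is not a strong blocking set in $\mathrm{PG}(N,q)$.
   Context: $\mathrm{PG}(N,q)$ denotes the $N$-dimensional projective space over the finite field $\mathbb{F}_q$. A strong blocking set in $\mathrm{PG}(N,q)$ is a set of points $\mathcal{S}$ such that for every hyperplane $H$, the points of $\mathcal{S}\cap H$ span $H$. A Baer subplane of $\mathrm{PG}(N,q)$ (which exists only when $q$ is a square) is the point set of a subgeometry $\mathrm{PG}(2,\sqrt{q})$ of a plane of $\mathrm{PG}(N,q)$, i.e. the set of points $\langle a u+b v+c w\rangle_{\mathbb{F}_q}$ with $(a,b,c)\in\mathbb{F}_{\sqrt q}^3\setminus\{0\}$, for some $\mathbb{F}_q$-linearly independent vectors $u,v,w$. *)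

(* Defs.v *)
From HB Require Import structures.
From mathcomp Require Import all_boot all_order all_algebra all_field.

Set Implicit Arguments.
Unset Strict Implicit.
Unset Printing Implicit Defensive.

Import GRing.Theory.
Local Open Scope ring_scope.

(* The library encodes a subspace as a canonical matrix, so the subspaces over a
   finite field form a finite type; only this instance uses the encoding. *)
Section FiniteVspace.
Import VectorInternalTheory.
Variables (F : finFieldType) (vT : vectType F).
HB.instance Definition _ := [Countable of {vspace vT} by <:].
HB.instance Definition _ := [Finite of {vspace vT} by <:].
End FiniteVspace.

(* PG(N, q), with q = #|F|, is the projective space of the row space
   'rV[F]_N.+1; projective dimension d means vector space dimension d.+1. *)
Record pg_point (F : finFieldType) (N : nat) := PGPoint {
  pg_line :> {vspace 'rV[F]_N.+1};
  _ : \dim pg_line == 1%N }.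

HB.instance Definition _ (F : finFieldType) (N : nat) :=
  [isSub for @pg_line F N].
HB.instance Definition _ (F : finFieldType) (N : nat) :=
  [Finite of pg_point F N by <:].

Section ProjectiveGeometry.

Variables (F : finFieldType) (N : nat).

Definition points_in (U : {vspace 'rV[F]_N.+1}) : {set pg_point F N} :=
  [set P : pg_point F N | (P <= U)%VS].

Definition pspan (S : {set pg_point F N}) : {vspace 'rV[F]_N.+1} :=
  (\sum_(P in S) pg_line P)%VS.

Definition strong_blocking_set (S : {set pg_point F N}) : Prop :=
  forall H : {vspace 'rV[F]_N.+1}, \dim H = N -> pspan (S :&: points_in H) = H.

Definition is_line (B : {set pg_point F N}) : Prop :=
  exists2 U : {vspace 'rV[F]_N.+1}, \dim U = 2%N & B = points_in U.

(* K is the subfield of order sqrt q; it exists only when q is a square. *)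
Definition is_Baer_subplane (B : {set pg_point F N}) : Prop :=
  exists (K : {set F}) (u v w : 'rV[F]_N.+1),
    [/\ GRing.divring_closed K, (#|K| ^ 2 = #|F|)%N, free [:: u; v; w]
      & forall P : pg_point F N, P \in B <->
          exists a b c : F,
            [/\ [/\ a \in K, b \in K & c \in K], (a, b, c) != (0, 0, 0)
              & pg_line P = <[a *: u + b *: v + c *: w]>%VS]].

End ProjectiveGeometry.

(* Main.v *)
Require Import Defs.
From mathcomp Require Import all_boot all_order all_algebra all_field.
From mathcomp Require Import zify.

Set Implicit Arguments.
Unset Strict Implicit.
Unset Printing Implicit Defensive.

Import GRing.Theory.
Local Open Scope ring_scope.

(** Let S be the union of the B_i and H the kernel of a nonzero linear form phi.
If some hyperplane H' different from H meets S only inside H, then S cannot be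
strong blocking: the points of S in H' span at most the intersection of H and
H', which is smaller than H'. So it is enough to find a hyperplane H outside
which S has few points, and a bound under which those few points can all be
avoided by a second hyperplane.

The avoidance bound is Jamison's theorem ([hyperplane_avoiding]): any N(q-1)
points outside H are avoided by a hyperplane H' <> H. Indeed, if x_1, ..., x_D
with D = N(q-1) are vectors off H, the polynomial psi |-> prod_j psi(x_j) on the
dual space F^(N+1) has degree D < (N+1)(q-1), so its values add up to 0
([sum_prod_linear_forms_eq0], the mechanism behind the Chevalley-Warning
theorem). If every psi outside the line <phi> killed some x_j, only the values
at the multiples c phi would remain, and these are c^D prod_j phi(x_j), with
c^D = 1 for c <> 0 because q-1 divides D; their sum is -prod_j phi(x_j) <> 0.

For the choice of H, a line or a Baer subplane spans at most a plane, so, as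
N >= 3, some H contains B_0 entirely, and only N-1 of the sets contribute points
off H. Both kinds of sets are F_k-linear sets of rank m with k^(m-1) = q: a line
has k = q and m = 2, a Baer subplane has k = sqrt q and m = 3. A form phi
restricted to k^m coefficient rows takes only q = k^(m-1) values, so its kernel
has at least k elements; each point off H comes from k-1 rows outside this
kernel, and so there are at most k(q-1)/(k-1) such points
([card_points_off_linear_set]). The assumption q >= N^2 gives N <= k, that is
(N-1)k <= N(k-1), so that each set has at most N(q-1)/(N-1) points off H, and
the N-1 sets together have at most N(q-1). *)

(** * Avoiding points by hyperplanes *)

Lemma sum_expr_eq0 (F : finFieldType) (m : nat) :
  (m < #|F|.-1)%N -> \sum_(a : F) a ^+ m = 0.
Proof.
case: m => [_|m ltmq].
  have Sa : \sum_(a : F) a = \sum_(a : F) (a + 1).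
    exact: (reindex_inj (addIr 1)).
  under eq_bigr do rewrite expr0.
  by apply: (addrI (\sum_(a : F) a)); rewrite addr0 -big_split.
(* Multiplying the sum by b^(m+1) permutes its terms; such a b exists because
   X^(m+1) - 1 has at most m+1 < q-1 roots. *)
have [b b0 bm] : exists2 b : F, b != 0 & b ^+ m.+1 != 1.
  apply/exists_inP; apply: contraLR ltmq; rewrite negb_exists_in -leqNgt.
  move=> /forall_inP roots; rewrite -(cardC1 (0 : F)) cardE.
  apply: max_unity_roots; rewrite ?enum_uniq //; apply/allP=> b.
  rewrite mem_enum => b0; rewrite unity_rootE.
  by have := roots b b0; rewrite negbK.
have Sb : \sum_(a : F) a ^+ m.+1 = b ^+ m.+1 * \sum_(a : F) a ^+ m.+1.
  rewrite mulr_sumr (reindex_inj (mulfI b0)) /=.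
  by apply: eq_bigr => a _; rewrite exprMn.
apply/eqP; have/eqP := Sb; rewrite -subr_eq0 -{1}[\sum_(a : F) _]mul1r -mulrBl.
by rewrite mulf_eq0 subr_eq0 eq_sym (negPf bm).
Qed.

(** A product of d linear forms in n variables expands into monomials of degree
d < n(q-1). In each of them some variable has exponent less than q-1, and summing
over that variable already gives 0. *)
Lemma sum_prod_linear_forms_eq0 (F : finFieldType) (n d : nat)
    (a : 'I_d -> 'I_n -> F) : (d < n * #|F|.-1)%N ->
  \sum_(y : {ffun 'I_n -> F}) \prod_(j < d) \sum_(k < n) a j k * y k = 0.
Proof.
move=> ltd.
under eq_bigr => y _ do rewrite bigA_distr_bigA /=.
rewrite exchange_big big1 //= => f _.
(* f selects one summand in each factor; m k is the exponent of y_k in the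
   resulting monomial. *)
pose m k := #|[pred j | f j == k]|.
have split_y (y : {ffun 'I_n -> F}) :
    \prod_j (a j (f j) * y (f j)) = (\prod_j a j (f j)) * \prod_k y k ^+ m k.
  rewrite big_split /= [X in _ * X](partition_big f predT) //=.
  congr (_ * _); apply: eq_bigr => k _.
  by under eq_bigr => j /eqP fj do rewrite fj; rewrite prodr_const.
under eq_bigr => y _ do rewrite split_y.
rewrite -mulr_sumr -(bigA_distr_bigA (fun k (b : F) => b ^+ m k)).
suff /existsP [k ltk] : [exists k, m k < #|F|.-1]%N.
  by rewrite (bigD1 k) //= sum_expr_eq0 // mul0r mulr0.
apply: contraLR ltd; rewrite negb_exists -leqNgt => /forallP big.
have -> : d = (\sum_k m k)%N.
  rewrite -[LHS]card_ord -sum1_card (partition_big f predT) //=.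
  by apply: eq_bigr => k _; rewrite sum1_card.
rewrite -[X in (X * _)%N]card_ord -sum_nat_const; apply: leq_sum => k _.
by rewrite leqNgt big.
Qed.

Definition form (F : finFieldType) (n : nat) (y : 'cV[F]_n) (x : 'rV[F]_n) : F :=
  (x *m y) 0 0.

Lemma formZl (F : finFieldType) (n : nat) (c : F) (y : 'cV[F]_n) x :
  form (c *: y) x = c * form y x.
Proof. by rewrite /form -scalemxAr mxE. Qed.

Lemma formZr (F : finFieldType) (n : nat) (c : F) (y : 'cV[F]_n) x :
  form y (c *: x) = c * form y x.
Proof. by rewrite /form -scalemxAl mxE. Qed.

Lemma formBr (F : finFieldType) (n : nat) (y : 'cV[F]_n) x z :
  form y (x - z) = form y x - form y z.
Proof. by rewrite /form mulmxBl !mxE. Qed.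

Lemma form_neq0 (F : finFieldType) (n : nat) (y : 'cV[F]_n) :
  y != 0 -> exists x, form y x != 0.
Proof.
move=> /matrix0Pn [i [j yij]]; exists (delta_mx 0 i).
by rewrite /form -rowE mxE -(ord1 j).
Qed.

(** Jamison's theorem in projective form. With s a list of representatives of
points off the hyperplane phi = 0, the form psi defines a different hyperplane
missing all these points. *)
Lemma hyperplane_avoiding (F : finFieldType) (N : nat) (phi : 'cV[F]_N.+1)
    (s : seq 'rV[F]_N.+1) :
    (0 < N)%N -> phi != 0 -> (size s <= N * #|F|.-1)%N ->
    {in s, forall x, form phi x != 0} ->
  exists2 psi, forall c, psi != c *: phi & {in s, forall x, form psi x != 0}.
Proof.
move=> N0 phi0 les offs; have q1 : (1 < #|F|)%N := finNzRing_gt1 F.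
have [x0 phix0] := form_neq0 phi0.
set D := (N * #|F|.-1)%N in les; have D0 : (0 < D)%N by rewrite muln_gt0 N0; lia.
(* The list is padded with x0 to exactly N(q-1) vectors: the degree has to be a
   positive multiple of q-1 for the values at the multiples of phi not to cancel. *)
pose x (j : 'I_D) := nth x0 s j.
have offx j : form phi (x j) != 0.
  rewrite /x; have [ltj|/(nth_default x0) -> //] := ltnP j (size s).
  exact/offs/mem_nth.
pose onspan psi := [exists c, psi == c *: phi].
suff /existsP [psi /andP[nspan nz]] :
    [exists psi, ~~ onspan psi && (\prod_j form psi (x j) != 0)].
  exists psi => [c|y ys].
    by apply: contra nspan => /eqP->; apply/existsP; exists c.
  have ltj : (index y s < D)%N by apply: leq_trans les; rewrite index_mem.
  have /prodf_neq0 /(_ (Ordinal ltj) isT) := nz.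
  by rewrite /x /= nth_index.
apply/contraT; rewrite negb_exists => /forallP van.
have sum0 : \sum_(psi : 'cV[F]_N.+1) \prod_j form psi (x j) = 0.
  rewrite (reindex (fun y : {ffun 'I_N.+1 -> F} => \col_k y k)) /=; last first.
    exists (fun psi : 'cV_N.+1 => [ffun k => psi k 0]) => [y|psi] _.
      by apply/ffunP=> k; rewrite ffunE mxE.
    by apply/colP=> k; rewrite mxE ffunE.
  rewrite -[RHS](@sum_prod_linear_forms_eq0 F N.+1 D (fun j k => x j 0 k)).
    apply: eq_bigr => y _; apply: eq_bigr => j _; rewrite /form mxE.
    by apply: eq_bigr => k _; rewrite mxE.
  by rewrite /D ltn_pmul2r; lia.
have injphi : injective (fun c : F => c *: phi).
  move=> c d /eqP; rewrite -subr_eq0 -scalerBl scaler_eq0 (negPf phi0) orbF.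
  by rewrite subr_eq0 => /eqP.
move: sum0; rewrite (bigID onspan) /= [X in _ + X]big1 ?addr0; last first.
  by move=> psi nspan; have:= van psi; rewrite nspan negbK => /eqP.
rewrite (eq_bigl (fun psi => psi \in [set c *: phi | c in F])); last first.
  move=> psi; apply/existsP/imsetP => [[c /eqP->]|[c _ ->]]; by exists c.
rewrite big_imset /=; last by move=> c d _ _; apply: injphi.
have prodZ c : \prod_j form (c *: phi) (x j) = c ^+ D * \prod_j form phi (x j).
  under eq_bigr do rewrite formZl.
  by rewrite big_split prodr_const card_ord.
under eq_bigr do rewrite prodZ.
rewrite -mulr_suml => /eqP; rewrite mulf_eq0 => /orP[|/prodf_eq0[j _]]; last first.
  by rewrite (negPf (offx j)).
rewrite (bigD1 0) //= expr0n gtn_eqF // add0r.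
under eq_bigr => c c0.
  have cq : c ^+ #|F|.-1 = 1.
    by apply: (mulfI c0); rewrite -exprS prednK ?mulr1 ?expf_card //; lia.
  rewrite /D mulnC exprM cq expr1n; over.
have /eqP := @sum_expr_eq0 F 0 ltac:(lia).
rewrite (bigD1 0) //= expr0 => S1 S2.
move: S1; under eq_bigr do rewrite expr0.
by rewrite (eqP S2) addr0 oner_eq0.
Qed.

(** * Points of a linear set off a hyperplane *)

(** Every nonempty fibre of g on A is a translate of the kernel, and there are at
most #|W| fibres. *)
Lemma leq_card_kernel (V : finZmodType) (W : finZmodType) (A : {set V})
    (g : V -> W) : {in A &, forall x y, x - y \in A} -> {morph g : x y / x - y} ->
  (#|A| <= #|W| * #|[set x in A | g x == 0%R]|)%N.
Proof.
move=> AB gB; rewrite -sum1_card (partition_big g predT) //= -sum_nat_const.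
apply: leq_sum => w _; rewrite sum1_card.
have [x0 /andP[Ax0 /eqP gx0]|empty] := pickP [pred x in A | g x == w]; last first.
  by rewrite (eq_card0 empty).
rewrite -(card_imset _ (addIr (- x0))); apply/subset_leq_card/subsetP => y.
case/imsetP=> x /andP[Ax /eqP gx] ->.
by rewrite inE AB //= gB gx gx0 subrr.
Qed.

Definition rows_over (F : finFieldType) (K : {set F}) (m : nat) :
    {set 'rV[F]_m} :=
  [set c : 'rV[F]_m | [forall i, c 0 i \in K]].

Lemma card_rows_over (F : finFieldType) (K : {set F}) (m : nat) :
  #|rows_over K m| = (#|K| ^ m)%N.
Proof.
rewrite -[in RHS](card_ord m) -card_ffun_on.
rewrite -(card_imset _ (_ : injective (fun f : {ffun 'I_m -> F} => \row_i f i))).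
  apply: eq_card => c; rewrite inE; apply/forallP/imsetP => [cK|[f /ffun_onP fK ->] i].
    exists [ffun i => c 0 i]; first by apply/ffun_onP => i; rewrite ffunE.
    by apply/rowP=> i; rewrite mxE ffunE.
  by rewrite mxE.
by move=> f g /rowP fg; apply/ffunP=> i; have := fg i; rewrite !mxE.
Qed.

(** For a subfield K, the points generated by the K-combinations of the rows of E
form what finite geometry calls an F_K-linear set of rank m. *)
Definition sub_linear_set (F : finFieldType) (N : nat) (K : {set F}) (m : nat)
    (E : 'M[F]_(m, N.+1)) (B : {set pg_point F N}) : Prop :=
  forall P, P \in B ->
    exists2 c, c \in rows_over K m & pg_line P = <[c *m E]>%VS.

Definition point_vec (F : finFieldType) (N : nat) (P : pg_point F N) :
    'rV[F]_N.+1 :=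
  vpick (pg_line P).

Lemma point_vec_neq0 (F : finFieldType) (N : nat) (P : pg_point F N) :
  point_vec P != 0.
Proof. by case: P => P dimP; rewrite /point_vec vpick0 -dimv_eq0 /= (eqP dimP). Qed.

Lemma pg_lineE (F : finFieldType) (N : nat) (P : pg_point F N) :
  pg_line P = <[point_vec P]>%VS.
Proof.
apply/esym/eqP; rewrite eqEdim -memvE memv_pick dim_vline point_vec_neq0.
by case: P => P /= /eqP->.
Qed.

Definition points_off (F : finFieldType) (N : nat) (phi : 'cV[F]_N.+1)
    (B : {set pg_point F N}) : {set pg_point F N} :=
  [set P in B | form phi (point_vec P) != 0].

Lemma form_point_vec_eq0 (F : finFieldType) (N : nat) (phi : 'cV[F]_N.+1)
    (P : pg_point F N) x :
  pg_line P = <[x]>%VS -> (form phi x == 0) = (form phi (point_vec P) == 0).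
Proof.
move=> Px; have /vlineP [k kP] : point_vec P \in <[x]>%VS.
  by rewrite -Px pg_lineE memv_line.
rewrite kP formZr mulf_eq0; have := point_vec_neq0 P.
by rewrite kP scaler_eq0 negb_or => /andP[/negPf-> _].
Qed.

(** The form phi has a kernel of at least #|K| elements on the coefficient rows
over K, so at most #|K|^m - #|K| rows give vectors off phi = 0. Each point off
phi = 0 absorbs #|K| - 1 of them, the nonzero K-multiples of one row. *)
Lemma card_points_off_linear_set (F : finFieldType) (N : nat) (K : {set F})
    (m : nat) (E : 'M[F]_(m, N.+1)) (B : {set pg_point F N}) (phi : 'cV[F]_N.+1) :
    GRing.divring_closed K -> (0 < m)%N -> #|F| = (#|K| ^ m.-1)%N ->
    sub_linear_set K E B ->
  (#|points_off phi B| * #|K|.-1 <= #|K| * #|F|.-1)%N.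
Proof.
move=> [K1 KB Kdiv] m0 qE BE.
have K0 : 0 \in K by rewrite -(subrr 1) KB.
have KM a b : a \in K -> b \in K -> a * b \in K.
  move=> Ka Kb; have [->|b0] := eqVneq b 0; first by rewrite mulr0.
  by rewrite -[b]invrK Kdiv // -div1r Kdiv.
pose g c : F := form phi (c *m E).
have kerK : (#|K| <= #|[set c in rows_over K m | g c == 0%R]|)%N.
  have k0 : (0 < #|K|)%N by apply/card_gt0P; exists 0.
  have F0 : (0 < #|F|)%N by apply/card_gt0P; exists 0.
  rewrite -(leq_pmul2l F0) [in leqLHS]qE -expnSr prednK // -card_rows_over.
  apply: leq_card_kernel => [c d|c d]; last first.
    by rewrite /g mulmxBl formBr.
  rewrite !inE => /forallP cK /forallP dK; apply/forallP => i.
  by rewrite !mxE KB.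
pose X := [set c in rows_over K m | g c != 0].
have cardX : (#|X| + #|K| <= #|K| ^ m)%N.
  rewrite -card_rows_over -(cardsID [set c | g c == 0] (rows_over K m)) addnC leq_add //.
    by apply: leq_trans kerK _; apply/subset_leq_card/subsetP => c; rewrite !inE.
  by apply/subset_leq_card/subsetP => c; rewrite !inE => /andP[-> ->].
suff : (#|points_off phi B| * #|K|.-1 <= #|X|)%N.
  move=> le; have : (#|K| * #|F|.-1 = #|K| ^ m - #|K|)%N.
    by rewrite -[in RHS](prednK m0) expnS -qE -subn1 mulnBr muln1.
  by lia.
pose coord (P : pg_point F N) : 'rV[F]_m :=
  odflt 0 [pick c in rows_over K m | pg_line P == <[c *m E]>%VS].
have coordP P : P \in B ->
    coord P \in rows_over K m /\ pg_line P = <[coord P *m E]>%VS.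
  move=> PB; rewrite /coord; case: pickP => [c /andP[cK /eqP]|none] //.
  by have [c cK /eqP Pc] := BE P PB; have := none c; rewrite /= cK Pc.
(* h sends a point and a nonzero scalar of K to a row outside the kernel of g;
   the row determines the point it generates, and then the scalar. *)
pose h (u : pg_point F N * F) := u.2 *: coord u.1.
have -> : (#|points_off phi B| * #|K|.-1 =
           #|h @: setX (points_off phi B) (K :\ 0%R)|)%N.
  rewrite card_in_imset ?cardsX; first by rewrite (cardsD1 0 K) K0.
  move=> [P a] [Q b]; rewrite !inE /h /= => /andP[/andP[PB _] /andP[a0 _]].
  move=> /andP[/andP[QB _] /andP[b0 _]] eqh.
  have [_ Pl] := coordP P PB; have [_ Ql] := coordP Q QB.
  have PQ : P = Q.
    apply: val_inj; rewrite /= Pl Ql.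
    have scal c (v : 'rV[F]_N.+1) : c != 0 -> <[c *: v]>%VS = <[v]>%VS.
      move=> c0; apply/eqP; rewrite eqEsubv -!memvE memvZ ?memv_line //=.
      by rewrite -[v in v \in _](scalerK c0) memvZ // memv_line.
    by rewrite -(scal a _ a0) -(scal b (_ *m E) b0) !scalemxAl eqh.
  subst Q; congr (_, _); move/eqP: eqh; rewrite -subr_eq0 -scalerBl scaler_eq0.
  rewrite subr_eq0 => /orP[/eqP //|/eqP c0]; have := point_vec_neq0 P.
  have : point_vec P \in <[coord P *m E]>%VS by rewrite -Pl pg_lineE memv_line.
  rewrite c0 mul0mx => /vlineP[k ->]; by rewrite scaler0 eqxx.
apply/subset_leq_card/subsetP => _ /imsetP[[P a] /= u ->]; move: u.
rewrite !inE /h /= => /andP[/andP[PB offP] /andP[a0 aK]].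
have [] := coordP P PB; rewrite inE => /forallP cK Pl; apply/andP; split.
  by apply/forallP=> i; rewrite mxE KM.
by rewrite /g -scalemxAl formZr mulf_neq0 // (form_point_vec_eq0 phi Pl).
Qed.

(** * Lines and Baer subplanes *)

Lemma line_linear_set (F : finFieldType) (N : nat) (B : {set pg_point F N}) :
  is_line B -> exists E : 'M[F]_(2, N.+1), sub_linear_set [set: F] E B.
Proof.
move=> [U dimU ->]; rewrite -dimU.
exists (\matrix_i (vbasis U)`_i) => P; rewrite inE pg_lineE => PU.
exists (\row_i coord (vbasis U) i (point_vec P)).
  by rewrite inE; apply/forallP => i; rewrite inE.
congr (<[_]>%VS); rewrite mulmx_sum_row [LHS](coord_vbasis (U := U)).
  by apply: eq_bigr => i _; rewrite mxE rowK.
by rewrite memvE.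
Qed.

Lemma Baer_linear_set (F : finFieldType) (N : nat) (B : {set pg_point F N}) :
    is_Baer_subplane B ->
  exists (K : {set F}) (E : 'M[F]_(3, N.+1)),
    [/\ GRing.divring_closed K, #|F| = (#|K| ^ 2)%N & sub_linear_set K E B].
Proof.
move=> [K [u [v [w [Kdiv cardK _ BP]]]]].
exists K, (\matrix_i [:: u; v; w]`_i); split=> // P.
move=> /BP[a [b [c [[Ka Kb Kc] _ ->]]]].
exists (\row_i [:: a; b; c]`_i).
  by rewrite inE; apply/forallP => -[[|[|[|i]]] lti]; rewrite mxE.
by rewrite mulmx_sum_row !big_ord_recl big_ord0 !mxE !rowK /= addr0 !addrA.
Qed.

Lemma line_or_Baer_linear_set (F : finFieldType) (N : nat)
    (B : {set pg_point F N}) :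
    is_line B \/ is_Baer_subplane B ->
  exists (K : {set F}) (m : nat) (E : 'M[F]_(m, N.+1)),
    [/\ (1 < m <= 3)%N, GRing.divring_closed K, #|F| = (#|K| ^ m.-1)%N
      & sub_linear_set K E B].
Proof.
case=> [/line_linear_set [E BE]|/Baer_linear_set [K [E [Kdiv cardK BE]]]].
  exists [set: F], 2%N, E; split=> //; last by rewrite cardsT expn1.
  by split=> [|x y _ _|x y _ _]; rewrite inE.
by exists K, 3%N, E.
Qed.

(** As #|K|^(m-1) = q >= N^2 and m - 1 <= 2, one has N <= #|K|, hence
(N-1) #|K| <= N (#|K|-1); this turns the bound #|K| (q-1) / (#|K|-1) on the number
of points off phi = 0 into N (q-1) / (N-1). *)
Lemma card_points_off_line_or_Baer (F : finFieldType) (N : nat)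
    (B : {set pg_point F N}) (phi : 'cV[F]_N.+1) : (1 < N)%N -> (N ^ 2 <= #|F|)%N ->
    is_line B \/ is_Baer_subplane B ->
  (N.-1 * #|points_off phi B| <= N * #|F|.-1)%N.
Proof.
move=> N1 leNq /line_or_Baer_linear_set[K [m [E [/andP[m1 m3] Kdiv qE BE]]]].
have leNk : (N <= #|K|)%N.
  have k0 : (0 < #|K|)%N.
    by apply/card_gt0P; exists 1; case: Kdiv.
  rewrite -(leq_exp2r _ _ (isT : 0 < 2)%N) (leq_trans leNq) // qE.
  by rewrite leq_pexp2l //; lia.
have := card_points_off_linear_set phi Kdiv (ltnW m1) qE BE.
move: #|points_off phi B| #|K| #|F|.-1 leNk => t k r leNk le.
rewrite -(leq_pmul2r (_ : 0 < k.-1)%N); last by lia.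
apply: (@leq_trans (N.-1 * (k * r))%N); first by rewrite -mulnA leq_mul2l le orbT.
have leNk' : (N.-1 * k <= N * k.-1)%N by nia.
by rewrite mulnA [(N * r * _)%N]mulnAC leq_mul2r leNk' orbT.
Qed.

(** * Kernels of linear forms as hyperplanes *)

Lemma hyperplane_through (F : finFieldType) (N m : nat) (E : 'M[F]_(m, N.+1)) :
  (m <= N)%N -> exists2 phi : 'cV[F]_N.+1, phi != 0 & E *m phi = 0.
Proof.
move=> lemN; have /matrix0Pn [i [j ij]] : cokermx E != 0.
  rewrite -mxrank_eq0 mxrank_coker subn_eq0 -ltnNge ltnS.
  exact: leq_trans (rank_leq_row E) lemN.
exists (col j (cokermx E)); first by apply/matrix0Pn; exists i, 0; rewrite mxE.
by rewrite colE mulmxA mulmx_coker mul0mx.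
Qed.

Definition ker_form (F : finFieldType) (n : nat) (y : 'cV[F]_n) :
    {vspace 'rV[F]_n} :=
  lker (linfun (mulmxr y : 'rV[F]_n -> 'M[F]_1)).

Lemma mem_ker_form (F : finFieldType) (n : nat) (y : 'cV[F]_n) x :
  (x \in ker_form y) = (form y x == 0).
Proof.
rewrite memv_ker lfunE /= /form.
apply/eqP/eqP => [->|xy]; first by rewrite mxE.
by rewrite [LHS]mx11_scalar xy raddf0.
Qed.

Lemma dim_ker_form (F : finFieldType) (N : nat) (y : 'cV[F]_N.+1) :
  y != 0 -> \dim (ker_form y) = N.
Proof.
move=> y0; have := limg_ker_dim (linfun (mulmxr y : 'rV[F]_N.+1 -> 'M[F]_1)) fullv.
rewrite capfv dimvf /dim /= mul1n.
set d := \dim (limg _); suff -> : d = 1%N by rewrite addn1 => -[].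
apply/eqP; rewrite eqn_leq; apply/andP; split.
  have := dimvS (subvf (limg (linfun (mulmxr y : 'rV[F]_N.+1 -> 'M[F]_1)))).
  by rewrite dimvf /dim.
have [x yx] := form_neq0 y0; rewrite lt0n dimv_eq0; apply: contra yx => /eqP im0.
rewrite -mem_ker_form memv_ker -memv0 -im0; exact: memv_img (memvf x).
Qed.

(** Evaluating phi on psi(e) x - psi(x) e, which lies in the kernel of psi, gives
psi(x) phi(e) = phi(x) psi(e) for every e. *)
Lemma ker_form_sub (F : finFieldType) (n : nat) (phi psi : 'cV[F]_n) :
    phi != 0 -> psi != 0 -> (ker_form psi <= ker_form phi)%VS ->
  exists c, psi = c *: phi.
Proof.
move=> phi0 psi0 /subvP sub; have [x psix] := form_neq0 psi0.
pose c := form phi x / form psi x.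
have phiE : phi = c *: psi.
  apply/colP=> i.
  have formi (y : 'cV[F]_n) : y i 0 = form y (delta_mx 0 i).
    by rewrite /form -rowE mxE.
  rewrite formi [RHS]formi formZl; set e := delta_mx 0 i.
  have : form psi e *: x - form psi x *: e \in ker_form psi.
    by rewrite mem_ker_form formBr !formZr mulrC subrr.
  move=> /sub; rewrite mem_ker_form formBr !formZr subr_eq0 => /eqP eqe.
  by apply: (mulfI psix); rewrite -eqe mulrA [_ * c]mulrC divfK // mulrC.
have c0 : c != 0 by apply: contra phi0 => /eqP c0; rewrite phiE c0 scale0r.
by exists c^-1; rewrite phiE scalerK.
Qed.

(** * Unions of lines and Baer subplanes *)

Lemma points_off_eq0 (F : finFieldType) (N m : nat) (K : {set F})
    (E : 'M[F]_(m, N.+1)) (B : {set pg_point F N}) (phi : 'cV[F]_N.+1) :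
  sub_linear_set K E B -> E *m phi = 0 -> points_off phi B = set0.
Proof.
move=> BE Ephi; apply/setP => P; rewrite !inE; apply/andP=> -[/BE[c _ Pl]].
by rewrite -(form_point_vec_eq0 phi Pl) /form -mulmxA Ephi mulmx0 mxE eqxx.
Qed.

(** A hyperplane through one of the sets: that set contributes no point, and each
of the N-1 others contributes at most N (q-1) / (N-1). *)
Lemma hyperplane_few_points_off (F : finFieldType) (N : nat)
  (hN : (3 <= N)%N) (hq : (N ^ 2 <= #|F|)%N)
  (B : 'I_N -> {set pg_point F N})
  (hB : forall i : 'I_N, is_line (B i) \/ is_Baer_subplane (B i)) :
  exists2 phi : 'cV[F]_N.+1, phi != 0 &
   (#|points_off phi (\bigcup_(i < N) B i)%SET| <= N * #|F|.-1)%N.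
Proof.
have N0 : (0 < N)%N by lia.
pose i0 : 'I_N := Ordinal N0.
have [K [m [E [/andP[_ m3] _ _ BE]]]] := line_or_Baer_linear_set (hB i0).
have [phi phi0 Ephi] := hyperplane_through E (leq_trans m3 hN).
exists phi => //.
have offU : points_off phi (\bigcup_(i < N) B i)%SET
    \subset (\bigcup_(i | i != i0) points_off phi (B i))%SET.
  apply/subsetP=> P; rewrite inE => /andP[/bigcupP[i _ PBi] offP].
  have offPi : P \in points_off phi (B i) by rewrite inE PBi.
  apply/bigcupP; exists i => //; apply/eqP => ii0.
  by move: offPi; rewrite ii0 (points_off_eq0 BE Ephi) inE.
have N1 : (0 < N.-1)%N by lia.
pose t := (\sum_(i | i != i0) #|points_off phi (B i)|)%N.
rewrite -(leq_pmul2l N1) (leq_trans (_ : _ <= N.-1 * t)%N) //.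
  rewrite leq_mul2l (leq_trans (subset_leq_card offU)) ?orbT // /t.
  elim/big_rec2: _ => [|i n A _ leA]; first by rewrite cards0.
  by rewrite (leq_trans (leq_card_setU _ _)) ?leq_add2l.
have -> : (N.-1 * (N * #|F|.-1) = \sum_(i | i != i0) N * #|F|.-1)%N.
  by rewrite sum_nat_const cardC1 card_ord.
rewrite /t big_distrr; apply: leq_sum => i _.
by apply: card_points_off_line_or_Baer => //; lia.
Qed.

Theorem corollary2p4 (F : finFieldType) (N : nat)
  (hN : (3 <= N)%N) (hq : (N ^ 2 <= #|F|)%N)
  (B : 'I_N -> {set pg_point F N})
  (hB : forall i : 'I_N, is_line (B i) \/ is_Baer_subplane (B i)) :
  ~ strong_blocking_set (\bigcup_(i < N) B i)%SET.
Proof.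
have [phi phi0 few] := hyperplane_few_points_off hN hq hB.
set S := (\bigcup_(i < N) B i)%SET in few *.
have [|x|psi notspan offpsi] := @hyperplane_avoiding F N phi
    [seq point_vec P | P <- enum (points_off phi S)] (ltnW (ltnW hN)) phi0.
- by rewrite size_map -cardE.
- by move=> /mapP[P]; rewrite mem_enum inE => /andP[_ offP] ->.
have psi0 : psi != 0 by have := notspan 0; rewrite scale0r.
move=> /(_ _ (dim_ker_form psi0)) spanS.
have [c /eqP] : exists c, psi = c *: phi; last by rewrite (negPf (notspan c)).
apply: ker_form_sub => //; rewrite -spanS.
apply/subv_sumP => P; rewrite !inE => /andP[PS].
rewrite pg_lineE -!memvE !mem_ker_form; apply: contraTT => offP.
by apply: offpsi; apply: map_f; rewrite mem_enum inE PS.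
Qed.
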